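(* The potential, taken with $WB=1$, is an invariant of starred links and linkoids that lie in a surface of genus $g\ge 0$. That is, if $L$ and $L'$ are star equivalent oriented starred link or linkoid diagrams in a closed connected oriented surface $\Sigma_g$, then $\nabla_L(W,B)=\nabla_{L'}(W,B)$ whenever $WB=1$ (i.e. after substituting $B=W^{-1}$).
   Context: Surfaces are closed, connected and oriented. A linkoid diagram in a surface is a generic immersion of finitely many unit intervals (long components, also called knotoid components) and circles, with finitely many transverse double points, each carrying over/under information (crossings); the endpoints of the long components are distinct from each other and from the crossings. The initial endpoint of a long component is its tail and the terminal endpoint its head, and long components are oriented from tail to head. A link diagram is the case with only circles. The universe of a diagram is the graph obtained by turning each crossing into a 4-valent vertex and each endpoint into a 1-valent vertex; the regions (faces) are the connected components of the complement of the universe. Diagrams are assumed tightly embedded (every region is a disk); every diagram in $S^2$ is counted as tightly embedded. A starred diagram is a diagram together with stars placed either on some of its regions or on some of its crossings (possibly no stars) so that the number of unstarred regions equals the number of unstarred crossings. Two starred diagrams are star equivalent if they are related by isotopy of the surface and finitely many Reidemeister moves RI, RII, RIII, performed away from the endpoints and away from the starred regions/crossings: a star on a region is regarded as a marked point across which no strand may be moved, a starred crossing takes part in no move, strands may not be moved across starred crossings or across endpoints, and stars are never added or deleted. All diagrams in the sequence are starred diagrams. A starred link or linkoid is a star equivalence class of starred diagrams. Labels. At each crossing of an oriented diagram there are four local regions (corners): the out-corner (between the two outgoing edges), the in-corner (between the two incoming edges) and two side corners. At a positive crossing the out-corner has label $W$, the in-corner has label $-B$, and both side corners have label $1$. At a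 negative crossing the out-corner has label $B$, the in-corner has label $-W$, and both side corners have label $1$. A state of a starred diagram assigns to every unstarred region one marker, placed at a corner of that region at an unstarred crossing, so that every unstarred crossing receives exactly one marker (if a region occupies several corners at one crossing, different corners give different states). The weight $\langle L|S\rangle$ of a state $S$ is the product of the labels of the marked corners. The potential is $\nabla_L(W,B)=\sum_S\langle L|S\rangle$, summed over all states of $L$, where $W,B$ are commuting variables. *)

(* Defs.v *)
From mathcomp Require Import all_boot all_algebra.
From Stdlib Require Export Relation_Operators.

Set Implicit Arguments.
Unset Strict Implicit.
Unset Printing Implicit Defensive.

Import GRing.Theory.

(** A dart is an edge of the universe together with one of its two ends; it is
    thought of as leaving the vertex at that end.
    - [opp d] is the other dart of the same edge.
    - [nxt d] is the next dart counterclockwise around the vertex of [d], so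
      vertices are the orbits of [nxt].  A vertex of valence 4 is a crossing and
      one of valence 1 is an endpoint of a long component.  A vertex of valence
      2 is a mere joint, an auxiliary point with no meaning of its own: it is
      there so that a circle without crossings has an edge, and joints are
      created and deleted freely by [subdivision] below.
    - [out d] says that the strand through [d] is oriented away from the vertex
      of [d].  A tail is thus an endpoint with [out d], a head one without.
    - [over d] says that [d] belongs to the over strand of its crossing.
    - A dart [d] also names the corner between [d] and [nxt d] at its vertex, and
      [region_of d] is the region containing this corner.  It lies to the left
      of the edge of [d] when one walks away from the vertex of [d], whence
      [region_of_walk]: the orbits of [opp \o nxt] are the closed walks along
      the boundary of the regions.

    A region is a planar surface with one boundary circle for each boundary walk
    it contains, so its Euler characteristic is 2 minus the number of its
    boundary walks.  Regions with several boundary walks, which occur for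
    diagrams with disconnected universe, are allowed only in the sphere, where
    planarity of the regions is automatic. *)

Record diagram (g : nat) := Diagram {
  dart : finType;
  region : finType;
  opp : dart -> dart;
  nxt : dart -> dart;
  out : pred dart;
  over : pred dart;
  region_of : dart -> region;

  opp_involutive : involutive opp;
  out_opp : forall d, out (opp d) = ~~ out d;

  nxt_injective : injective nxt;
  valence_nxt : forall d, order nxt d \in [:: 1; 2; 4];
  out_joint : forall d, order nxt d = 2 -> out (nxt d) = ~~ out d;
  out_crossing : forall d, order nxt d = 4 -> out (nxt (nxt d)) = ~~ out d;
  over_crossing : forall d, order nxt d = 4 -> over (nxt d) = ~~ over d;
  (* [over] is meaningless elsewhere, and normalised to [false] *)
  over_other : forall d, order nxt d != 4 -> ~~ over d;

  region_of_walk : forall d, region_of (opp (nxt d)) = region_of d;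

  (* The surface is connected: one can go from any region to any other by
     walking across edges. *)
  surface_connected :
    n_comp (fun r s => [exists d, (region_of d == r) && (region_of (nxt d) == s)])
      region = 1;
  (* The surface has Euler characteristic
     V - E + \sum_(r : region) (2 - #boundary walks of r) = 2 - 2 g. *)
  surface_genus :
    fcard nxt dart + 2 * #|region| + 2 * g
      = fcard opp dart + fcard (opp \o nxt) dart + 2;
  (* Tightly embedded: a region with a single boundary walk is a disk. *)
  tight : 0 < g ->
    forall d e, region_of d = region_of e -> fconnect (opp \o nxt) d e
}.

Section Crossings.
Variables (g : nat) (L : diagram g).
Implicit Type d : dart L.

Definition at_crossing d : bool := order (@nxt g L) d == 4.

Definition same_vertex d d' : bool := fconnect (@nxt g L) d d'.

End Crossings.

(** Stars are placed on regions and on crossings; the latter are given by the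
    set of all darts at the starred crossings. *)

Record starred_diagram (g : nat) := StarredDiagram {
  diagram_of :> diagram g;
  star_region : pred (region diagram_of);
  star_crossing : pred (dart diagram_of);
  star_crossing_at : forall d, star_crossing d -> at_crossing d;
  star_crossing_nxt : forall d, star_crossing (nxt d) = star_crossing d;
  star_balanced :
    #|[pred r | ~~ star_region r]|
      = fcard (@nxt g diagram_of)
          [pred d | at_crossing d && ~~ star_crossing d]
}.

Section Potential.
Variables (g : nat) (L : starred_diagram g).
Local Notation dart := (dart L).
Local Notation region := (region L).

(* A state is the set of its marked corners. *)
Definition is_state (S : {set dart}) : bool :=
  [&& [forall d in S, [&& at_crossing d, ~~ star_crossing d
                        & ~~ star_region (region_of d)]],
      [forall r : region,
         ~~ star_region r ==> (#|[set d in S | region_of d == r]| == 1)]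
    & [forall c : dart, at_crossing c && ~~ star_crossing c ==>
         (#|[set d in S | same_vertex c d]| == 1)]].

(* A crossing is positive when a counterclockwise quarter turn takes the outgoing
   over dart to the outgoing under dart.  The formula gives the same value at the
   four darts of the crossing. *)
Definition positive (d : dart) : bool := (out d == out (nxt d)) == over d.

Variables (A : comNzRingType) (W B : A).
Local Open Scope ring_scope.

Definition label (d : dart) : A :=
  if out d && out (nxt d) then if positive d then W else B
  else if ~~ out d && ~~ out (nxt d) then if positive d then - B else - W
  else 1.

Definition weight (S : {set dart}) : A := \prod_(d in S) label d.

Definition potential : A := \sum_(S : {set dart} | is_state S) weight S.

End Potential.

(** Isomorphism of combinatorial maps is the same as equivalence under an
    orientation preserving homeomorphism of the surface; in particular it holds
    for isotopic diagrams. *)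

Definition isotopic (g : nat) (L L' : starred_diagram g) : Prop :=
  exists (i : dart L -> dart L') (m : region L -> region L'),
  [/\ bijective i, bijective m,
      forall d, [/\ nxt (i d) = i (nxt d), opp (i d) = i (opp d),
                    out (i d) = out d & over (i d) = over d],
      forall d, region_of (i d) = m (region_of d)
    & (forall d, star_crossing (i d) = star_crossing d)
      /\ (forall r, star_region (m r) = star_region r)].

(** [L'] is obtained from [L] by cutting the edges of the darts in [cut] and
    adding the unstarred vertices whose darts are listed in [new]; [i] embeds the
    darts of [L] into those of [L'].  The map [m] sends a region of [L'] to the
    region of [L] of which it is a part, and to [None] if it is created by the
    move.  The regions of [L'] that are parts of [r] carry together exactly the
    star of [r], if any. *)

Definition extends (g : nat) (L L' : starred_diagram g)
    (cut : seq (dart L)) (new : seq (dart L'))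
    (i : dart L -> dart L') (m : region L' -> option (region L)) : Prop :=
  [/\ injective i /\ (forall d', (d' \in new) = (d' \notin codom i)),
      forall d, [/\ nxt (i d) = i (nxt d), out (i d) = out d,
                    over (i d) = over d & star_crossing (i d) = star_crossing d],
      forall d, d \notin cut -> opp (i d) = i (opp d),
      (forall d, m (region_of (i d)) = Some (region_of d))
      /\ (forall d', d' \in new -> ~~ star_crossing d')
    & (forall r', m r' = None -> ~~ star_region r')
      /\ (forall r, #|[set r' | (m r' == Some r) && star_region r']|
                    = star_region r)].

(** The joint added on the edge of [a] has the darts [u] and [nxt u]. *)

Definition subdivision (g : nat) (L L' : starred_diagram g) : Prop :=
  exists (a : dart L) (u : dart L')
         (i : dart L -> dart L') (m : region L' -> option (region L)),
  [/\ extends [:: a; opp a] (orbit (@nxt g L') u) i m,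
      order (@nxt g L') u = 2,
      opp (i a) = u /\ opp (i (opp a)) = nxt u
    & injective m /\ (forall r', m r' <> None)].

(** RI: a kink on the edge of [a], with crossing [c, nxt c, nxt^2 c, nxt^3 c].
    The strand arrives from [a] at [c], leaves at the opposite dart [nxt^2 c],
    comes back at [nxt^3 c] and leaves at [nxt c].  The kink of the other
    chirality is obtained by exchanging [a] and [opp a], and the choice of the
    over strand is free.  The corner [nxt^2 c] is the new monogon. *)

Definition reidemeister1 (g : nat) (L L' : starred_diagram g) : Prop :=
  exists (a : dart L) (c : dart L')
         (i : dart L -> dart L') (m : region L' -> option (region L)),
  [/\ extends [:: a; opp a] (orbit (@nxt g L') c) i m,
      at_crossing c,
      [/\ opp (i a) = c, opp (i (opp a)) = nxt c
        & opp (nxt (nxt c)) = nxt (nxt (nxt c))],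
      injective m
    & forall r', m r' = None <-> r' = region_of (nxt (nxt c))].

(** RII: the edges of [a] and [b], which have the same region to their left, are
    pushed over each other inside this region.  With the edge of [a] drawn at
    the bottom from left to right, and that of [b] at the top from right to
    left, the new crossings are [x] on the left and [y] on the right, and
<<
      opp b . <- n3 x      n y <- . b
                     \    /
          n2 x -->  upper arc  --> n2 y           (strand of [a])
          n x  <--  lower arc  <-- n3 y           (strand of [b])
                     /    \
            a . -> x        y -> . opp a
>>
    The bigon is the corner [nxt x].  The old region is cut into the region of
    [a], on the left, and that of [b], on the right (these coincide if [a] and
    [b] belong to different boundary walks). *)

Definition reidemeister2 (g : nat) (L L' : starred_diagram g) : Prop :=
  exists (a b : dart L) (x y : dart L')
         (i : dart L -> dart L') (m : region L' -> option (region L)),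
  [/\ [/\ a != b, b != opp a & region_of a = region_of b],
      extends [:: a; opp a; b; opp b]
        (orbit (@nxt g L') x ++ orbit (@nxt g L') y) i m,
      [/\ at_crossing x, at_crossing y, ~~ same_vertex x y & over x = over y],
      [/\ opp (i a) = x, opp (nxt (nxt x)) = nxt (nxt y) & opp (i (opp a)) = y]
      /\ [/\ opp (i b) = nxt y, opp (nxt (nxt (nxt y))) = nxt x
           & opp (i (opp b)) = nxt (nxt (nxt x))]
    & [/\ forall r', m r' = None <-> r' = region_of (nxt x),
          forall r', m r' = Some (region_of a) <->
            r' = region_of (i a) \/ r' = region_of (i b)
        & forall r' s', m r' = m s' -> r' = s' \/ m r' = Some (region_of a)]].

(** RIII: let [a], [b], [c] be the corners of a triangle, [opp a = nxt b] and
    cyclically.  The three strands run along the three edges of the triangle, and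
    each crosses the two others at its corners.  After the move the same three
    crossings remain, but each strand visits its two crossings in the other
    order.  Along the edge from [p] to [nxt q], the strand visits
    [nxt^2 p, p, nxt q, nxt^3 q]; exchanging its two crossings amounts to
    conjugating [opp] by the involution [slide].

    The triangle moves to the opposite corner [nxt^2 p] of each crossing, the
    region across the far edge of the triangle moves to the corner [p], and the
    regions at the corners opposite to the triangle at the two other crossings
    move to the side corners; [slide_corner] gives, for each corner after the
    move, a corner of the same region before the move. *)

Section Slide.
Variables (g : nat) (L : diagram g) (a b c : dart L).
Local Notation n1 := (@nxt g L).
Local Notation n2 d := (n1 (n1 d)).
Local Notation n3 d := (n1 (n1 (n1 d))).

Definition slide : dart L -> dart L :=
  [eta id with a |-> n3 b, n3 b |-> a, n2 a |-> n1 b, n1 b |-> n2 a,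
               b |-> n3 c, n3 c |-> b, n2 b |-> n1 c, n1 c |-> n2 b,
               c |-> n3 a, n3 a |-> c, n2 c |-> n1 a, n1 a |-> n2 c].

Definition slide_corner : dart L -> dart L :=
  [eta id with a |-> n3 b, n1 a |-> n2 c, n2 a |-> a, n3 a |-> n2 b,
               b |-> n3 c, n1 b |-> n2 a, n2 b |-> b, n3 b |-> n2 c,
               c |-> n3 a, n1 c |-> n2 b, n2 c |-> c, n3 c |-> n2 a].

(* A triangular disk with distinct crossings.  One of the strands passes over the
   two others, and one under the two others, if and only if the triangle is not
   alternating. *)
Definition triangle : Prop :=
  [/\ [/\ at_crossing a, at_crossing b & at_crossing c],
      [/\ ~~ same_vertex a b, ~~ same_vertex b c & ~~ same_vertex c a],
      [/\ opp a = nxt b, opp b = nxt c & opp c = nxt a],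
      forall d, region_of d = region_of a -> d \in [:: a; b; c]
    & ~~ ((over a == over b) && (over b == over c))].

End Slide.

Definition reidemeister3 (g : nat) (L L' : starred_diagram g) : Prop :=
  exists (a b c : dart L) (i : dart L -> dart L') (m : region L -> region L'),
  [/\ triangle a b c,
      [/\ ~~ star_crossing a, ~~ star_crossing b, ~~ star_crossing c
        & ~~ star_region (region_of a)],
      bijective i /\ bijective m,
      (forall d, [/\ nxt (i d) = i (nxt d),
                     opp (i (slide a b c d)) = i (slide a b c (opp d)),
                     out (i d) = out d & over (i d) = over d])
      /\ (forall d, region_of (i d) = m (region_of (slide_corner a b c d)))
    & (forall d, star_crossing (i d) = star_crossing d)
      /\ (forall r, star_region (m r) = star_region r)].

Definition star_move (g : nat) (L L' : starred_diagram g) : Prop :=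
  [\/ isotopic L L' \/ subdivision L L', reidemeister1 L L',
      reidemeister2 L L' | reidemeister3 L L'].

Definition star_equivalent (g : nat) : starred_diagram g -> starred_diagram g -> Prop :=
  clos_refl_sym_trans (starred_diagram g) (@star_move g).

(* Main.v *)
From mathcomp Require Import all_boot all_algebra.
From mathcomp Require Import ring.
Require Import Defs.

(** Only the markers at the crossings that take part in a move matter.  Expanding
    the state sum at these crossings leaves, for each list of regions that they
    mark, the sum over the remaining states in which these regions are already
    marked, and this remainder [F] is not affected by the move.  It is symmetric
    in the list and vanishes if a region occurs twice in it, or if a region all
    of whose corners are at the expanded crossings does not occur in it.

    - RI: the monogon must be marked at its only corner, which has label 1.
    - RII: the bigon must be marked; with [WB = 1] everything cancels except
      [F big ra + F big rb], where [ra] and [rb] are the two parts of the region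
      in which the move takes place.  Exactly one of them is marked elsewhere
      if this region is unstarred; if it is starred, the starred part
      contributes 0.
    - RIII: both diagrams give linear combinations of the values of [F] at the
      triangle and two of the six regions around it.  Their coefficients agree
      when [WB = 1], for all orientations and all non-alternating choices of the
      over strands. *)

Set Implicit Arguments.
Unset Strict Implicit.
Unset Printing Implicit Defensive.

Import GRing.Theory.
Local Open Scope ring_scope.

(** * Partial state sums *)

Lemma fconnect_eq (T : finType) (rT : Type) (f : T -> T) (K : T -> rT) x y :
  (forall z, K (f z) = K z) -> fconnect f x y -> K y = K x.
Proof.
by move=> Kf /iter_findex <-; elim: (findex f x y) => //= n <-; apply: Kf.
Qed.

Section StateSum.
Variables (D R : finType) (f : D -> D) (reg : D -> R) (live : pred R).
Variables (A : comNzRingType) (lab : D -> A).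
Implicit Types (K : pred D) (S : {set D}) (qs : seq R).

(** Booleans are read as 0 or 1, so a single equation demands one marker at each vertex in [K] and
    none elsewhere. *)
Definition marks K S : bool :=
  [forall c, (\sum_(d in S) fconnect f c d)%N == K c].

(** Entries of [qs] count like markers, with multiplicity, so moving a marker from [S] into [qs]
    changes nothing. *)
Definition covers S qs : bool :=
  [forall r, (count_mem r qs + \sum_(d in S) (reg d == r))%N == live r].

(* A partial state sum: only the crossings in [K] receive markers, and the
   regions in [qs] have already received theirs. *)
Definition state_sum K qs : A :=
  \sum_(S | marks K S) (\prod_(d in S) lab d) *+ covers S qs.

Lemma marks_live K S d : marks K S -> d \in S -> K d.
Proof.
move=> /forallP/(_ d)/eqP; move=> + dS; rewrite (bigD1 d dS) /= connect0.
by case: (K d).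
Qed.

Lemma covers_perm S qs qs' : perm_eq qs qs' -> covers S qs = covers S qs'.
Proof. by move=> /permP eqs; apply: eq_forallb => r; rewrite eqs. Qed.

Lemma covers_setU1 S d qs : d \notin S -> covers (d |: S) qs = covers S (reg d :: qs).
Proof.
by move=> dS; apply: eq_forallb => r; rewrite big_setU1 //= addnCA addnA.
Qed.

Lemma eq_state_sum_marks K K' qs : K =1 K' -> state_sum K qs = state_sum K' qs.
Proof.
by move=> eqK; apply: eq_bigl => S; apply: eq_forallb => c; rewrite eqK.
Qed.

Lemma state_sum_perm K qs qs' :
  perm_eq qs qs' -> state_sum K qs = state_sum K qs'.
Proof. by move=> eqs; apply: eq_bigr => S _; rewrite (covers_perm _ eqs). Qed.

Lemma state_sum_dup K r qs : (1 < count_mem r qs)%N -> state_sum K qs = 0.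
Proof.
move=> r2; apply: big1 => S _; rewrite (_ : covers _ _ = false) //.
apply/negbTE/forallPn; exists r; rewrite neq_ltn orbC.
by rewrite (leq_ltn_trans (leq_b1 _)) // (leq_trans r2) // leq_addr.
Qed.

Lemma state_sum_uncovered K r qs :
  live r -> r \notin qs -> (forall d, K d -> reg d != r) -> state_sum K qs = 0.
Proof.
move=> lr rqs Kr; apply: big1 => S mS; rewrite (_ : covers _ _ = false) //.
apply/negbTE/forallPn; exists r; rewrite lr (count_memPn rqs) big1 // => d dS.
by apply/eqP; rewrite eqb0 Kr // (marks_live mS dS).
Qed.

Hypothesis f_inj : injective f.

(** The side condition of the reindexing by [d |: S] in [state_sum_peel]; its second conjunct on the
    left says that [d] is not in [S]. *)
Lemma marks_setU1 K a d S : (forall c, K (f c) = K c) -> K a -> fconnect f a d ->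
  marks K (d |: S) && ((d |: S) :\ d == S)
    = marks (fun c => K c && ~~ fconnect f a c) S.
Proof.
move=> Kf Ka ad; have [dS|dS] := boolP (d \in S).
  transitivity false; last first.
    by apply/esym/negbTE/negP => /marks_live/(_ dS); rewrite ad andbF.
  by apply/negbTE/negP => /andP[_ /eqP/setP/(_ d)]; rewrite !inE eqxx dS.
rewrite setU1K // eqxx andbT; apply: eq_forallb => c; rewrite big_setU1 //=.
have fC := fconnect_sym f_inj; have [ac|ac] /= := boolP (fconnect f a c).
  rewrite andbF -(same_connect fC ac) ad (fconnect_eq Kf ac) Ka.
  by rewrite add1n eqSS.
rewrite andbT fC -(same_connect fC ad) (negbTE ac) //.
Qed.

(** The vertex of [a] carries exactly one marker [d]. Removing it and recording its region in the
    list is a bijection onto the marker sets at the remaining vertices. *)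
Lemma state_sum_peel K a qs : (forall c, K (f c) = K c) -> K a ->
  state_sum K qs = \sum_(d | fconnect f a d)
    lab d * state_sum (fun c => K c && ~~ fconnect f a c) (reg d :: qs).
Proof.
move=> Kf Ka; set G := fun S => (\prod_(d in S) lab d) *+ covers S qs.
(* The inner sum multiplies each term by the number of markers at the vertex of [a], which is 1. *)
transitivity (\sum_(S | marks K S) \sum_(d | fconnect f a d) G S *+ (d \in S)).
  apply: eq_bigr => S /forallP/(_ a); rewrite Ka => /eqP s1.
  rewrite -[LHS]mulr1n -[1%N in LHS]s1 -sumrMnr big_mkcond [RHS]big_mkcond /=.
  by apply: eq_bigr => d _; case: (d \in S); case: (fconnect f a d).
rewrite exchange_big; apply: eq_bigr => d ad /=.
transitivity (\sum_(S | marks K S && (d \in S)) G S).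
  by rewrite [RHS]big_mkcondr; apply: eq_bigr => S _; case: (d \in S).
rewrite (reindex_onto (fun S => d |: S) (fun S => S :\ d)) /=; last first.
  by move=> S /andP[_ dS]; rewrite setD1K.
rewrite big_distrr; apply: eq_big => [S|S].
  by rewrite setU11 andbT (marks_setU1 _ Kf Ka ad).
rewrite setU11 andbT (marks_setU1 _ Kf Ka ad) => mS.
have dS : d \notin S by apply/negP => /(marks_live mS); rewrite ad andbF.
by rewrite /G big_setU1 //= covers_setU1 // mulrnAr.
Qed.

Lemma state_sum_peel4 K a qs : (forall c, K (f c) = K c) -> K a ->
  order f a = 4 ->
  let Z d := lab d * state_sum (fun c => K c && ~~ fconnect f a c) (reg d :: qs) in
  state_sum K qs = Z a + Z (f a) + Z (f (f a)) + Z (f (f (f a))).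
Proof.
move=> Kf Ka a4 Z; rewrite (state_sum_peel _ Kf Ka).
rewrite (eq_bigl (mem (orbit f a))); last by move=> d; rewrite /= -fconnect_orbit.
rewrite -big_uniq ?orbit_uniq //= /orbit a4 /=.
by rewrite !big_cons big_nil addr0 !addrA.
Qed.
End StateSum.

(** * Transport of state sums along embeddings of darts *)

Section Transport.
Variables (D D' R' : finType) (f : D -> D) (f' : D' -> D').
Variables (reg' : D' -> R') (live' : pred R').
Variables (A : comNzRingType) (lab : D -> A) (lab' : D' -> A).
Variables (i : D -> D').
Hypotheses (i_inj : injective i) (f'_inj : injective f').
Hypothesis (i_f : forall d, f' (i d) = i (f d)).

Lemma fconnect_inj d e : fconnect f' (i d) (i e) = fconnect f d e.
Proof.
have it n x : iter n f' (i x) = i (iter n f x) by elim: n => //= n ->.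
apply/idP/idP => /iter_findex; last by move=> <-; rewrite -it fconnect_iter.
by rewrite it => /i_inj <-; rewrite fconnect_iter.
Qed.

Lemma fconnect_codom d e : fconnect f' (i d) e -> e \in codom i.
Proof.
have it n x : iter n f' (i x) = i (iter n f x) by elim: n => //= n ->.
by move=> /iter_findex <-; rewrite it codom_f.
Qed.

Lemma order_inj d : order f' (i d) = order f d.
Proof.
rewrite /order -(card_imset _ i_inj); apply: eq_card => e.
apply/idP/imsetP => [de|[x dx ->]]; last by rewrite inE fconnect_inj.
have /codomP[x ex] := fconnect_codom de.
by exists x => //; rewrite inE -fconnect_inj -ex.
Qed.

(** All vertices in [K'] lie in the image of [i], so every marker set for [K'] is the image of its
    preimage. The regions stay those of the target and are compared separately. *)
Lemma state_sum_transport (K : pred D) (K' : pred D') qs' :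
  (forall d, K' (i d) = K d) -> (forall d', K' d' -> d' \in codom i) ->
  (forall d, K d -> lab' (i d) = lab d) ->
  state_sum f' reg' live' lab' K' qs'
    = state_sum f (fun d => reg' (i d)) live' lab K qs'.
Proof.
move=> K'i K'c labi; rewrite /state_sum.
rewrite (reindex_onto (fun S : {set D} => i @: S) (fun S' => i @^-1: S')) /=; last first.
  move=> S' mS'; apply/setP => d'; apply/imsetP/idP => [[d]|d'S'].
    by rewrite inE => ? ->.
  have /codomP[d ed] := K'c _ (marks_live mS' d'S').
  by exists d; rewrite // inE -ed.
have mi (S : {set D}) : marks f' K' (i @: S) && (i @^-1: (i @: S) == S) = marks f K S.
  rewrite (_ : _ == S) ?andbT; last first.
    by apply/eqP/setP => d; rewrite inE mem_imset.
  apply/forallP/forallP => mS c.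
    have := mS (i c); rewrite K'i big_imset /=; last by move=> x y _ _ /i_inj.
    by under eq_bigr do rewrite fconnect_inj.
  rewrite big_imset /=; last by move=> x y _ _ /i_inj.
  have [/codomP[d ->]|nc] := boolP (c \in codom i).
    by rewrite K'i -(eqP (mS d)); under eq_bigr do rewrite fconnect_inj.
  (* A vertex outside the image gets no marker: an orbit that meets the image stays inside it. *)
  rewrite big1 => [|d _]; first by rewrite (contraNF (K'c c)).
  apply/eqP; rewrite eqb0; apply: contra nc.
  by rewrite (fconnect_sym f'_inj); apply: fconnect_codom.
apply: eq_big => [//|S]; rewrite mi => mS.
rewrite big_imset /=; last by move=> x y _ _ /i_inj.
congr (_ *+ _); first by apply: eq_bigr => d dS; rewrite labi // (marks_live mS dS).
congr nat_of_bool; apply: eq_forallb => r.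
by rewrite big_imset //=; move=> x y _ _ /i_inj.
Qed.
End Transport.

(** * The identities behind the moves *)

Section LocalIdentities.
Variables (A : comNzRingType) (W B : A).

(* The label of a corner [d] with [s = out d], [t = out (nxt d)], [o = over d]. *)
Definition corner_label (s t o : bool) : A :=
  if s && t then if (s == t) == o then W else B
  else if ~~ s && ~~ t then if (s == t) == o then - B else - W
  else 1.

(** Expansion at one crossing, [X] being the remainder as a function of the marked region. Opposite
    darts have opposite orientations and over alternates with under, so [s], [t], [o] determine all
    four labels. *)
Definition crossing_sum (R : Type) s t o (q0 q1 q2 q3 : R) (X : R -> A) : A :=
  corner_label s t o * X q0 + corner_label t (~~ s) (~~ o) * X q1
  + corner_label (~~ s) (~~ t) o * X q2 + corner_label (~~ t) s (~~ o) * X q3.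

Lemma eq_crossing_sum (R : Type) s t o
    (q0 q1 q2 q3 : R) (X Y : R -> A) : X =1 Y ->
  crossing_sum s t o q0 q1 q2 q3 X = crossing_sum s t o q0 q1 q2 q3 Y.
Proof. by move=> eqX; rewrite /crossing_sum !eqX. Qed.

Hypothesis WB : W * B = 1.

(** [u] and [v] lie beyond the two tips of the bigon, [p] and [q] across its sides. Exactly one
    marker is in the bigon; the terms with [p] or [q] cancel in pairs, and those with [u] or [v]
    have a coefficient equal to 1 or [W * B]. *)
Lemma crossing_sum_bigon (R : eqType) (F : R -> R -> A) s t o (big p q u v : R) :
  p != big -> q != big -> u != big -> v != big ->
  (forall x y, F x y = F y x) -> F big big = 0 ->
  (forall x y, x != big -> y != big -> F x y = 0) ->
  crossing_sum s t o p big q u (fun x =>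
    crossing_sum (~~ s) t o v q big p (fun y => F x y)) = F big u + F big v.
Proof.
move=> pb qb ub vb FC Fbb F0.
have FE x y : F x y = if x == big then if y == big then 0 else F big y
    else if y == big then F big x else 0.
  have [->|xb] := eqVneq x big; have [->|yb] //= := eqVneq y big.
  exact: F0.
move: (F big) FE => G FE; rewrite /crossing_sum !FE eqxx.
rewrite (negbTE pb) (negbTE qb) (negbTE ub) (negbTE vb).
by case: s t o => [] [] []; rewrite /corner_label /=; ring: WB.
Qed.

(** [fab] is the region across the edge of the triangle [T] between [a] and [b], and [ga] the one
    opposite to [T] at [a]. After the slide, [T] takes the place of [ga] at [a], and [fbc] that of
    [T]. *)
Lemma crossing_sum_triangle (R : eqType) (F : R -> R -> R -> A)
    sa sb sc oa ob oc (T fab fbc fca ga gb gc : R) :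
  ~~ ((oa == ob) && (ob == oc)) ->
  [/\ fab != T, fbc != T & fca != T] -> [/\ ga != T, gb != T & gc != T] ->
  (forall p q r, F p q r = F q p r) -> (forall p q r, F p q r = F p r q) ->
  (forall p q, F p q q = 0) ->
  (forall p q r, p != T -> q != T -> r != T -> F p q r = 0) ->
  crossing_sum sa (~~ sc) oa T fca ga fab (fun p =>
    crossing_sum sb (~~ sa) ob T fab gb fbc (fun q =>
      crossing_sum sc (~~ sb) oc T fbc gc fca (fun r => F p q r)))
  = crossing_sum sa (~~ sc) oa fbc gc T gb (fun p =>
      crossing_sum sb (~~ sa) ob fca ga T gc (fun q =>
        crossing_sum sc (~~ sb) oc fab gb T ga (fun r => F p q r))).
Proof.
move=> alt [fabT fbcT fcaT] [gaT gbT gcT] FC FA Fdup F0.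
(* By symmetry [T] can be moved to the front. This leaves [F T], called [G] below, which is
   symmetric and vanishes on equal arguments and at [T]. *)
have FE p q r : F p q r = if p == T then F T q r else if q == T then F T p r
    else if r == T then F T p q else 0.
  have [->//|pT] := eqVneq p T; have [->|qT] := eqVneq q T; first exact: FC.
  by have [->|rT] := eqVneq r T; [rewrite FA FC | apply: F0].
pose G := F T; have {}FE p q r : F p q r = if p == T then G q r
    else if q == T then G p r else if r == T then G p q else 0 by apply: FE.
have GC q r : G q r = G r q by apply: FA.
have Gd q : G q q = 0 by apply: Fdup.
have GT q : G T q = 0 by rewrite /G FA FC Fdup.
clearbody G.
rewrite /crossing_sum !FE !eqxx (negbTE fabT) (negbTE fbcT) (negbTE fcaT).
rewrite (negbTE gaT) (negbTE gbT) (negbTE gcT) {FE F0 FC FA Fdup} ?(GC _ T) !GT ?Gd.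
(* [ring] sees values of [G] as atoms, so their arguments are sorted in the order [fab], [fbc],
   [fca], [ga], [gb], [gc]. *)
rewrite ?(GC fbc fab) ?(GC fca fab) ?(GC ga fab) ?(GC gb fab) ?(GC gc fab).
rewrite ?(GC fca fbc) ?(GC ga fbc) ?(GC gb fbc) ?(GC gc fbc).
rewrite ?(GC ga fca) ?(GC gb fca) ?(GC gc fca).
rewrite ?(GC gb ga) ?(GC gc ga) ?(GC gc gb).
rewrite /corner_label.
by case: sa sb sc oa ob oc alt => [] [] [] [] [] [] //= _; ring: WB.
Qed.

End LocalIdentities.

(** * Diagrams *)

Section Diagram.
Variables (g : nat) (L : diagram g).
Implicit Types d e : dart L.

Lemma at_crossing_same_vertex d e : same_vertex d e -> at_crossing e = at_crossing d.
Proof.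
move=> de; rewrite /at_crossing /order.
rewrite (@eq_card _ (fconnect (@nxt g L) e) (fconnect (@nxt g L) d)) // => x.
by rewrite -!topredE /= (same_connect (fconnect_sym (@nxt_injective g L)) de).
Qed.

Lemma at_crossing_nxt d : at_crossing (nxt d) = at_crossing d.
Proof. by apply: at_crossing_same_vertex; apply: fconnect1. Qed.

Lemma same_vertex_nxt c d :
  same_vertex c (nxt d) = same_vertex c d.
Proof.
rewrite /same_vertex (fconnect_sym (@nxt_injective g L)) -same_fconnect1.
  exact: fconnect_sym (@nxt_injective g L) _ _.
exact: nxt_injective.
Qed.

Lemma orbit_crossing d : at_crossing d ->
  orbit (@nxt g L) d = [:: d; nxt d; nxt (nxt d); nxt (nxt (nxt d))].
Proof. by rewrite /orbit => /eqP->. Qed.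

Lemma nxt4 d : at_crossing d -> nxt (nxt (nxt (nxt d))) = d.
Proof. by move=> /eqP d4; rewrite -[RHS](iter_order (@nxt_injective g L)) d4. Qed.

Lemma region_of_opp d e : nxt d = opp e -> region_of e = region_of d.
Proof. by move=> de; rewrite -(region_of_walk d) de opp_involutive. Qed.

(** A path of adjacent regions leads from the region of [d0] to [r], and its last step exhibits a
    corner of [r]. A diagram without darts has one region and no corner, whence [d0]. *)
Lemma region_of_surjective (d0 : dart L) r : exists d : dart L, region_of d = r.
Proof.
have := surface_connected L.
set e := (e in n_comp e _) => n1.
have e_sym : symmetric e.
  have imp r1 r2 : e r1 r2 -> e r2 r1.
    case/existsP=> d /andP[/eqP dr1 /eqP dr2]; apply/existsP.
    (* The same edge crossed the other way: the corner just before its dart [opp (nxt d)]. *)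
    exists (finv (@nxt g L) (opp (nxt d))).
    rewrite f_finv ?region_of_walk ?dr1 ?eqxx ?andbT; last exact: nxt_injective.
    rewrite -dr2 -[nxt d in X in _ == X]opp_involutive.
    by rewrite -region_of_walk f_finv //; apply: nxt_injective.
  by move=> r1 r2; apply/idP/idP; apply: imp.
have c_sym := sym_connect_sym e_sym.
have root_eq : fingraph.root e r = fingraph.root e (region_of d0).
  by apply: (card_le1_eqP (eq_leq n1)); rewrite inE /= roots_root.
have /connectP[p ep rE] : connect e (region_of d0) r.
  by rewrite c_sym -root_connect // root_eq.
case/lastP: p => [|p r1] in ep rE; first by exists d0.
move: ep; rewrite rcons_path last_rcons in rE *; rewrite -rE.
by case/andP=> _ /existsP[d /andP[_ /eqP dr]]; exists (nxt d).
Qed.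

End Diagram.

(** * The potential as a state sum *)

Definition unstarred (g : nat) (L : starred_diagram g) (d : dart L) : bool :=
  at_crossing d && ~~ star_crossing d.

Section Potential.
Variables (g : nat) (L : starred_diagram g).
Implicit Types d e : dart L.

Lemma unstarred_nxt d : unstarred (nxt d) = unstarred d.
Proof. by rewrite /unstarred at_crossing_nxt star_crossing_nxt. Qed.

(** The balance condition counted in darts, four to a crossing. For RII it shows that the move
    really cuts the region. *)
Lemma balance :
  (4 * #|[pred r : region L | ~~ star_region r]|)%N = #|@unstarred g L|.
Proof.
rewrite star_balanced mulnC; apply: (fcard_order_set (@nxt_injective g L)).
  by apply/subsetP => d /andP[].
apply: intro_closed; first exact/fconnect_sym/nxt_injective.
by move=> d e /eqP <-; rewrite !inE -!/(unstarred _) unstarred_nxt.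
Qed.

(** [marks] and [covers] also demand that no marker is at a starred crossing, at a vertex that is no
    crossing, or in a starred region; the first clause of [is_state] provides this. *)
Lemma is_stateE (S : {set dart L}) : is_state S =
  marks (@nxt g L) (@unstarred g L) S
  && covers (@region_of g L) (fun r => ~~ star_region r) S [::].
Proof.
have cntE (P : pred (dart L)) : (\sum_(d in S) P d)%N = #|[set d in S | P d]|.
  by rewrite -sum1dep_card big_mkcondr; apply: eq_bigr => d _; case: (P d).
apply/and3P/andP => [[/forall_inP in_S /forallP one_r /forallP one_c]|].
  split; apply/forallP.
    move=> c; rewrite cntE; have := one_c c; rewrite -/(unstarred c) => {}one_c.
    have [uc|uc] := boolP (unstarred c); first exact: (implyP one_c).
    rewrite cards_eq0; apply/eqP/setP => d; rewrite !inE.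
    apply/negP => /andP[dS cd]; case/and3P: (in_S d dS) => d4 ds _.
    move: uc; rewrite -(fconnect_eq unstarred_nxt cd).
    by rewrite /unstarred d4 ds.
  move=> r; rewrite add0n cntE; have := one_r r => {}one_r.
  have [ur|ur] := boolP (~~ star_region r); first exact: (implyP one_r).
  rewrite cards_eq0; apply/eqP/setP => d; rewrite !inE.
  apply/negP => /andP[dS /eqP dr]; case/and3P: (in_S d dS) => _ _.
  by rewrite dr (negbTE ur).
case=> mS cS; split; last 1 first.
- apply/forallP => c; apply/implyP => uc.
  by have := forallP mS c; rewrite cntE [unstarred c]uc.
- apply/forall_inP => d dS; have /andP[-> ->] := marks_live mS dS => /=.
  have := forallP cS (region_of d); rewrite add0n (bigD1 d dS) /= eqxx.
  by case: (star_region _).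
apply/forallP => r; apply/implyP => ur.
by have := forallP cS r; rewrite add0n cntE ur.
Qed.

Variables (A : comNzRingType) (W B : A).

Lemma potentialE : potential L W B =
  state_sum (@nxt g L) (@region_of g L) (fun r => ~~ star_region r)
    (label W B) (@unstarred g L) [::].
Proof.
rewrite /potential /state_sum (eq_bigl _ _ is_stateE) big_mkcondr.
by apply: eq_bigr => S _; case: covers.
Qed.

Lemma labelE d : label W B d = corner_label W B (out d) (out (nxt d)) (over d).
Proof. by []. Qed.

Lemma state_sum_crossing (R : finType) (reg : dart L -> R) (live : pred R)
    (K : pred (dart L)) c qs :
  (forall d, K (nxt d) = K d) -> K c -> at_crossing c ->
  state_sum (@nxt g L) reg live (label W B) K qs =
  crossing_sum W B (out c) (out (nxt c)) (over c)
    (reg c) (reg (nxt c)) (reg (nxt (nxt c))) (reg (nxt (nxt (nxt c))))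
    (fun q => state_sum (@nxt g L) reg live (label W B)
       (fun d => K d && ~~ same_vertex c d) (q :: qs)).
Proof.
move=> Kn Kc c4; have n4 d : at_crossing (nxt d) = at_crossing d.
  exact: at_crossing_nxt.
rewrite (state_sum_peel4 _ _ _ (@nxt_injective g L) _ Kn Kc (eqP c4)).
rewrite /crossing_sum !labelE nxt4 //.
have oc d : at_crossing d -> out (nxt (nxt d)) = ~~ out d.
  by move=> /eqP/out_crossing.
have ov d : at_crossing d -> over (nxt d) = ~~ over d.
  by move=> /eqP/over_crossing.
by rewrite !oc ?ov ?n4 // !negbK.
Qed.

End Potential.

(** * The moves *)

Section StateSumRegion.
Variables (D R R' : finType) (f : D -> D) (reg : D -> R) (reg' : D -> R').
Variables (live : pred R) (live' : pred R').
Variables (A : comNzRingType) (lab : D -> A).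

Lemma state_sum_region_bij (m : R -> R') (K : pred D) qs : bijective m ->
  (forall r, live' (m r) = live r) -> (forall d, K d -> reg' d = m (reg d)) ->
  state_sum f reg' live' lab K (map m qs) = state_sum f reg live lab K qs.
Proof.
case=> m' mK m'K livem regm; apply: eq_bigr => S mS; congr (_ *+ nat_of_bool _).
have mI := can_inj mK.
have cntE r : (\sum_(d in S) (reg' d == m r) = \sum_(d in S) (reg d == r))%N.
  apply: eq_bigr => d dS.
  by rewrite (regm d (marks_live mS dS)) (inj_eq mI).
have memE r : count_mem (m r) (map m qs) = count_mem r qs.
  by rewrite count_map; apply: eq_count => q /=; rewrite (inj_eq mI).
apply/forallP/forallP => cS r; first by rewrite -cntE -memE -livem.
by rewrite -(m'K r) cntE memE livem.
Qed.

End StateSumRegion.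

(** * Moves that add vertices *)

Section Extends.
Variables (g : nat) (L L' : starred_diagram g).
Variables (cut : seq (dart L)) (new : seq (dart L')).
Variables (i : dart L -> dart L') (m : region L' -> option (region L)).
Hypothesis ext : extends cut new i m.

Lemma extends_inj : injective i. Proof. by case: ext => -[]. Qed.

Lemma extends_codom d' : (d' \in codom i) = (d' \notin new).
Proof. by case: ext => -[_ ->]; rewrite negbK. Qed.

Lemma extends_nxt d : nxt (i d) = i (nxt d).
Proof. by case: ext => _ /(_ d)[]. Qed.

Lemma extends_region d : m (region_of (i d)) = Some (region_of d).
Proof. by case: ext => _ _ _ []. Qed.

Lemma extends_unstarred d : unstarred (i d) = unstarred d.
Proof.
rewrite /unstarred /at_crossing (order_inj extends_inj extends_nxt).
by case: ext => _ /(_ d)[_ _ _ ->].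
Qed.

Lemma extends_label (A : comNzRingType) (W B : A) d :
  label W B (i d) = label W B d.
Proof.
by case: ext => _ i_d _ _ _; rewrite !labelE; case: (i_d d) => -> -> -> _;
  case: (i_d (nxt d)) => _ -> _ _.
Qed.

(** Once the new crossings are expanded, all markers are at old darts with unchanged labels. Only
    the coverings of the regions remain to be compared with those of [L]. *)
Lemma extends_state_sum (A : comNzRingType) (W B : A) (K' : pred (dart L')) qs' :
  (forall d', K' d' = unstarred d' && (d' \notin new)) ->
  state_sum (@nxt g L') (@region_of g L') (fun r' => ~~ star_region r')
    (label W B) K' qs'
  = state_sum (@nxt g L) (fun d => region_of (i d)) (fun r' => ~~ star_region r')
      (label W B) (@unstarred g L) qs'.
Proof.
move=> K'E; apply: state_sum_transport => [||||d'|d _].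
- exact: extends_inj.
- exact: nxt_injective.
- exact: extends_nxt.
- by move=> d; rewrite K'E extends_unstarred -extends_codom codom_f andbT.
- by rewrite K'E -extends_codom => /andP[].
- exact: extends_label.
Qed.

(** For a region that is not cut: its parts together carry its star, so a sole part carries exactly
    this star. *)
Lemma extends_fiber r r' : m r' = Some r ->
  (forall s', m s' = Some r -> s' = r') ->
  (forall d, (region_of (i d) == r') = (region_of d == r))
  /\ star_region r' = star_region r.
Proof.
move=> mr' r'_only; split=> [d|].
  apply/eqP/eqP => [dr'|dr].
    by have := extends_region d; rewrite dr' mr' => -[].
  by apply: r'_only; rewrite extends_region dr.
case: ext => _ _ _ _ [_ /(_ r)].
have [r'S|r'S] := boolP (star_region r').
  rewrite (cardD1 r') inE mr' eqxx r'S /=.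
  by case: (star_region r).
rewrite (_ : [set _ | _] = set0) ?cards0; first by case: (star_region r).
apply/setP => s'; rewrite !inE; apply/negP => /andP[/eqP/r'_only-> r's].
by rewrite r's in r'S.
Qed.

Lemma extends_region_surj (d0 : dart L) r : exists r', m r' = Some r.
Proof.
have [d <-] := region_of_surjective d0 r.
by exists (region_of (i d)); apply: extends_region.
Qed.

(** The created regions contain no old corner and are marked once by [qs']; [m] matches the other
    regions with those of [L]. *)
Lemma extends_covers (d0 : dart L) S qs' : injective m ->
  (forall r', count_mem r' qs' = (m r' == None)) ->
  covers (fun d => region_of (i d)) (fun r' => ~~ star_region r') S qs'
  = covers (@region_of g L) (fun r => ~~ star_region r) S [::].
Proof.
move=> m_inj qs'E.
have rE r r' : m r' = Some r ->
    (\sum_(d in S) (region_of (i d) == r') = \sum_(d in S) (region_of d == r))%N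
    /\ star_region r' = star_region r.
  move=> mr'; have [|iE ->] := extends_fiber mr'.
    by move=> s'; rewrite -mr' => /m_inj.
  by split=> //; apply: eq_bigr => d _; rewrite iE.
apply/forallP/forallP => cS r.
  have [r' mr'] := extends_region_surj d0 r.
  by have := cS r'; rewrite qs'E mr' add0n /=; have [-> ->] := rE _ _ mr'.
rewrite qs'E; case mr': (m r) => [s|].
  by have [-> ->] := rE _ _ mr'; apply: cS.
case: ext => _ _ _ _ [/(_ r mr') -> _].
rewrite big1 // => d _; apply/eqP; rewrite eqb0; apply/eqP => dr.
by have := extends_region d; rewrite dr mr'.
Qed.

End Extends.

(** * Isotopy, subdivision and RI *)

Section Moves.
Variables (g : nat) (A : comNzRingType) (W B : A).
Implicit Types L : starred_diagram g.

Lemma potential_isotopic L L' : isotopic L L' -> potential L W B = potential L' W B.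
Proof.
case=> i [m [i_bij m_bij i_nxt i_reg [i_star m_star]]]; apply/esym.
have i_inj := bij_inj i_bij.
have i_n d : nxt (i d) = i (nxt d) by case: (i_nxt d).
rewrite !potentialE.
rewrite (@state_sum_transport _ _ _ (@nxt g L) _ _ _ _ (label W B) _ i i_inj
  (@nxt_injective g L') i_n (@unstarred g L)); first last.
- move=> d _; rewrite !labelE; case: (i_nxt d) => -> _ -> ->.
  by case: (i_nxt (nxt d)) => _ _ -> _.
- by move=> d' _; case: i_bij => j _ jK; rewrite -(jK d') codom_f.
- by move=> d; rewrite /unstarred /at_crossing (order_inj i_inj i_n) i_star.
by apply: (@state_sum_region_bij _ _ _ _ _ _ _ _ _ _ m _ [::]) => // r;
  rewrite m_star.
Qed.

Lemma potential_subdivision L L' :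
  subdivision L L' -> potential L W B = potential L' W B.
Proof.
case=> a [u [i [m [ext u2 _ [m_inj m_total]]]]]; apply/esym.
(* The joint is not a crossing, so no unstarred dart is new. *)
rewrite !potentialE (extends_state_sum ext) => [|d']; last first.
  have [|_] := boolP (d' \in _); last by rewrite andbT.
  rewrite -fconnect_orbit andbF => /at_crossing_same_vertex d'u.
  by rewrite /unstarred d'u /at_crossing u2.
apply: eq_bigr => S _; rewrite (extends_covers ext a) // => r'.
by case mr': (m r') => //; have := m_total r'.
Qed.

Lemma potential_reidemeister1 L L' :
  reidemeister1 L L' -> potential L W B = potential L' W B.
Proof.
case=> a [c [i [m [ext c4 [oa oa' oc] m_inj mono]]]]; apply/esym.
have new4 d : d \in orbit (@nxt g L') c -> ~~ star_crossing d.
  by case: ext => _ _ _ [_ /(_ d)].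
have c_new : c \in orbit (@nxt g L') c by rewrite -fconnect_orbit connect0.
have uc : unstarred c by rewrite /unstarred c4 new4.
rewrite !potentialE (state_sum_crossing _ _ _ _ _ (@unstarred_nxt g L') uc c4).
set K' := fun d => unstarred d && ~~ same_vertex c d.
have K'E d : K' d = unstarred d && (d \notin orbit (@nxt g L') c).
  by rewrite /K' -fconnect_orbit.
set r0 := region_of (nxt (nxt c)).
have r0N : m r0 = None by apply/mono.
have i_r0 d : region_of (i d) != r0.
  by apply: contra_eqN r0N => /eqP <-; rewrite (extends_region ext).
(* No old corner lies in the monogon, which therefore stays unmarked unless the new crossing marks
   it. *)
have ucov q : q != r0 -> state_sum (@nxt g L') (@region_of g L')
    (fun r' => ~~ star_region r') (label W B) K' [:: q] = 0.
  move=> qr0; apply: (@state_sum_uncovered _ _ _ _ _ _ _ _ r0).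
  - by case: ext => _ _ _ _ [/(_ r0 r0N)].
  - by rewrite inE eq_sym.
  - move=> d; rewrite K'E -(extends_codom ext) => /andP[_ /codomP[e ->]].
    exact: i_r0.
(* The boundary walk reaches [opp (i e)] from the old corner just before [e], which is not in the
   monogon. *)
have prev d (e : dart L) : d = opp (i e) -> region_of d != r0.
  move=> ->; have ne := f_finv (@nxt_injective g L) e.
  by rewrite -ne -(extends_nxt ext) region_of_walk.
have c_r0 : region_of c != r0 by apply: (@prev _ a).
have nc_r0 : region_of (nxt c) != r0 by apply: (@prev _ (opp a)).
have n3c_r0 : region_of (nxt (nxt (nxt c))) != r0.
  by rewrite -region_of_walk (nxt4 c4) -oa opp_involutive.
rewrite /crossing_sum (ucov _ c_r0) (ucov _ nc_r0) (ucov _ n3c_r0).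
rewrite !mulr0 !add0r addr0.
(* The two ends of the loop have opposite orientations, so the monogon is at a side corner, with
   label 1. *)
have oE : out (nxt (nxt (nxt c))) = ~~ out (nxt (nxt c)).
  by rewrite -oc out_opp.
have [oc2 oc3] : out (nxt (nxt c)) = ~~ out c /\ out (nxt (nxt (nxt c))) = ~~ out (nxt c).
  by rewrite !out_crossing //; apply/eqP; rewrite -/(at_crossing _) ?at_crossing_nxt.
have -> : corner_label W B (~~ out c) (~~ out (nxt c)) (over c) = 1.
  by move: oE; rewrite oc2 oc3; case: (out c); case: (out (nxt c)).
rewrite mul1r (extends_state_sum ext) //.
apply: eq_bigr => S _; rewrite (extends_covers ext a) // => r' /=.
rewrite addn0; congr nat_of_bool; apply/eqP/eqP => [<- //|/mono //].
Qed.
End Moves.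

(** * RIII *)

Section Triangle.
Variables (g : nat) (A : comNzRingType) (W B : A).
Variables (L : starred_diagram g) (a b c : dart L).
Hypothesis abc : triangle a b c.
Hypotheses (sa : ~~ star_crossing a) (sb : ~~ star_crossing b)
  (sc : ~~ star_crossing c) (sT : ~~ star_region (region_of a)).

Let K d := [&& unstarred d, ~~ same_vertex a d, ~~ same_vertex b d
  & ~~ same_vertex c d].

(** [reg] is arbitrary so that the expansion serves both before the slide, with [region_of], and
    after it, with [R1]. *)
Lemma triangle_state_sum (reg : dart L -> region L) :
  state_sum (@nxt g L) reg (fun r => ~~ star_region r) (label W B)
    (@unstarred g L) [::]
  = crossing_sum W B (out a) (out (nxt a)) (over a)
    (reg a) (reg (nxt a)) (reg (nxt (nxt a))) (reg (nxt (nxt (nxt a)))) (fun p =>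
  crossing_sum W B (out b) (out (nxt b)) (over b)
    (reg b) (reg (nxt b)) (reg (nxt (nxt b))) (reg (nxt (nxt (nxt b)))) (fun q =>
  crossing_sum W B (out c) (out (nxt c)) (over c)
    (reg c) (reg (nxt c)) (reg (nxt (nxt c))) (reg (nxt (nxt (nxt c)))) (fun r =>
  state_sum (@nxt g L) reg (fun r => ~~ star_region r) (label W B) K [:: r; q; p]))).
Proof.
case: abc => [[a4 b4 c4] [ab bc ca] _ _ _].
have ac : ~~ same_vertex a c.
  by rewrite /same_vertex (fconnect_sym (@nxt_injective g L)).
rewrite (state_sum_crossing _ _ _ _ _ _ _ a4) ?/unstarred ?a4 //; last first.
  exact: unstarred_nxt.
apply: eq_crossing_sum => p.
rewrite (state_sum_crossing _ _ _ _ _ _ _ b4) ?b4 ?sb //; last first.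
  by move=> d; rewrite same_vertex_nxt -!/(unstarred _) unstarred_nxt.
apply: eq_crossing_sum => q.
rewrite (state_sum_crossing _ _ _ _ _ _ _ c4) ?c4 ?sc ?ac ?bc //; last first.
  by move=> d; rewrite !same_vertex_nxt -!/(unstarred _) unstarred_nxt.
apply: eq_crossing_sum => r; apply: eq_state_sum_marks => d.
by rewrite /K /unstarred !andbA.
Qed.

(** The three vertices are distinct, so their orbits are disjoint; this decides the case
    distinctions in [slide_corner]. *)
Lemma triangle_uniq : uniq [:: a; nxt a; nxt (nxt a); nxt (nxt (nxt a));
  b; nxt b; nxt (nxt b); nxt (nxt (nxt b));
  c; nxt c; nxt (nxt c); nxt (nxt (nxt c))].
Proof.
case: abc => [[a4 b4 c4] [ab bc ca] _ _ _].
have nC := fconnect_sym (@nxt_injective g L).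
have orb_disj d e : ~~ same_vertex d e ->
    ~~ has (mem (orbit (@nxt g L) d)) (orbit (@nxt g L) e).
  move=> de; apply/hasPn => x /=; rewrite -!fconnect_orbit => ex.
  by apply: contra de => dx; apply: connect_trans dx _; rewrite nC.
rewrite -[_ :: _]/([:: _; _; _; _] ++ [:: _; _; _; _] ++ [:: _; _; _; _]).
rewrite -!orbit_crossing // !cat_uniq has_cat negb_or !orbit_uniq !orb_disj //.
by rewrite /same_vertex nC.
Qed.

(** The regions after the move, pulled back to the darts of [L]. *)
Let R1 d := region_of (slide_corner a b c d).

Ltac split_uniq :=
  repeat match goal with H : is_true (_ && _) |- _ => move/andP: H => [? ?] end.
Ltac use_uniq :=
  repeat match goal with H : is_true (?x != ?y) |- _ =>
    rewrite ?(negbTE H) ?[y == x]eq_sym ?(negbTE H); clear H end.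

Lemma triangle_slide_corner :
  [/\ [/\ R1 a = region_of (nxt (nxt (nxt b))), R1 (nxt a) = region_of (nxt (nxt c)),
          R1 (nxt (nxt a)) = region_of a
        & R1 (nxt (nxt (nxt a))) = region_of (nxt (nxt b))],
      [/\ R1 b = region_of (nxt (nxt (nxt c))), R1 (nxt b) = region_of (nxt (nxt a)),
          R1 (nxt (nxt b)) = region_of b
        & R1 (nxt (nxt (nxt b))) = region_of (nxt (nxt c))]
    & [/\ R1 c = region_of (nxt (nxt (nxt a))), R1 (nxt c) = region_of (nxt (nxt b)),
          R1 (nxt (nxt c)) = region_of c
        & R1 (nxt (nxt (nxt c))) = region_of (nxt (nxt a))]].
Proof.
have := triangle_uniq; rewrite /= !inE !negb_or => U; split_uniq.
rewrite /R1 /slide_corner /= !eqxx.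
use_uniq.
by [].
Qed.

Lemma slide_corner_other d : K d -> slide_corner a b c d = d.
Proof.
case/and4P => _; rewrite /same_vertex !fconnect_orbit.
case: abc => [[a4 b4 c4] _ _ _ _]; rewrite !orbit_crossing // !inE !negb_or.
move=> Ua Ub Uc; split_uniq; rewrite /slide_corner /=.
by use_uniq.
Qed.

Lemma triangle_regions : [/\ region_of b = region_of a, region_of c = region_of a,
   region_of (nxt b) = region_of (nxt (nxt (nxt a))),
   region_of (nxt c) = region_of (nxt (nxt (nxt b)))
 & region_of (nxt a) = region_of (nxt (nxt (nxt c)))].
Proof.
case: abc => [[a4 b4 c4] _ [oa ob oc] _ _].
split; first by apply/esym/region_of_opp.
- exact/region_of_opp.
- by apply: region_of_opp; rewrite nxt4 // -oa opp_involutive.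
- by apply: region_of_opp; rewrite nxt4 // -ob opp_involutive.
- by apply: region_of_opp; rewrite nxt4 // -oc opp_involutive.
Qed.

Lemma triangle_slide : W * B = 1 ->
  state_sum (@nxt g L) R1 (fun r => ~~ star_region r) (label W B) (@unstarred g L) [::]
  = state_sum (@nxt g L) (@region_of g L) (fun r => ~~ star_region r) (label W B)
      (@unstarred g L) [::].
Proof.
move=> WB; rewrite !triangle_state_sum.
have [[-> -> -> ->] [-> -> -> ->] [-> -> -> ->]] := triangle_slide_corner.
have [rb rc rnb rnc rna] := triangle_regions.
case: (abc) => _ _ [oa ob oc] inT alt; rewrite rb rc rnb rnc rna.
have [-> -> ->] : [/\ out (nxt a) = ~~ out c, out (nxt b) = ~~ out a
    & out (nxt c) = ~~ out b] by rewrite -oa -ob -oc !out_opp.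
have notT d : d \notin [:: a; b; c] -> region_of d != region_of a.
  by apply: contraNneq => /inT.
(* Only corners at the three crossings are slid, so the remainder is the same before and after. *)
have RK qs : state_sum (@nxt g L) R1 (fun r => ~~ star_region r) (label W B) K qs
    = state_sum (@nxt g L) (@region_of g L) (fun r => ~~ star_region r) (label W B) K qs.
  apply: eq_bigr => S mS; congr (_ *+ nat_of_bool _); apply: eq_forallb => r.
  congr (_ + _ == _)%N; apply: eq_bigr => d /(marks_live mS)/slide_corner_other Kd.
  by rewrite /R1 Kd.
etransitivity.
  do 3 apply: eq_crossing_sum => ?; exact: RK.
apply/esym/crossing_sum_triangle => //.
- have := triangle_uniq; rewrite /= !inE !negb_or => U; split_uniq.
  by split; apply: notT; rewrite !inE; use_uniq.
- have := triangle_uniq; rewrite /= !inE !negb_or => U; split_uniq.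
  by split; apply: notT; rewrite !inE; use_uniq.
- move=> p q r; apply/state_sum_perm; rewrite perm_cons.
  by apply/permP=> x /=; rewrite addnCA.
- by move=> p q r; apply/state_sum_perm/permP=> x /=; rewrite addnCA.
- by move=> p q; apply: (@state_sum_dup _ _ _ _ _ _ _ _ q); rewrite /= eqxx.
move=> p q r pT qT rT; apply: (@state_sum_uncovered _ _ _ _ _ _ _ _ (region_of a)) => //.
  by rewrite !inE ![region_of a == _]eq_sym (negbTE pT) (negbTE qT) (negbTE rT).
move=> d /and4P[_ ad bd cd]; apply: notT; rewrite !inE.
by apply/negP => /or3P[] /eqP de; move: ad bd cd; rewrite de /same_vertex connect0.
Qed.
End Triangle.

(** Labels depend on [nxt], [out] and [over], which [i] preserves, but not on [opp]. Hence the state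
    sum of [L'] is that of [L] with slid corners, up to renaming regions by [m]. *)
Lemma potential_reidemeister3 (g : nat) (A : comNzRingType) (W B : A)
    (L L' : starred_diagram g) : W * B = 1 ->
  reidemeister3 L L' -> potential L W B = potential L' W B.
Proof.
move=> WB [a [b [c [i [m [abc [sa sb sc sT] [i_bij m_bij] [i_d i_reg]
  [i_star m_star]]]]]]]; apply/esym.
have i_inj := bij_inj i_bij.
have i_n d : nxt (i d) = i (nxt d) by case: (i_d d).
rewrite !potentialE.
rewrite (@state_sum_transport _ _ _ (@nxt g L) _ _ _ _ (label W B) _ i i_inj
  (@nxt_injective g L') i_n (@unstarred g L)); first last.
- move=> d _; rewrite !labelE; case: (i_d d) => -> _ -> ->.
  by case: (i_d (nxt d)) => _ _ -> _.
- by move=> d' _; case: i_bij => j _ jK; rewrite -(jK d') codom_f.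
- by move=> d; rewrite /unstarred /at_crossing (order_inj i_inj i_n) i_star.
rewrite -(triangle_slide abc sa sb sc sT WB).
by apply: (@state_sum_region_bij _ _ _ _ _ _ _ _ _ _ m _ [::]) => // r;
  rewrite m_star.
Qed.

(** * RII *)

Section ExtendsSplit.
Variables (g : nat) (L L' : starred_diagram g).
Variables (cut : seq (dart L)) (new : seq (dart L')).
Variables (i : dart L -> dart L') (m : region L' -> option (region L)).
Hypothesis ext : extends cut new i m.
Variables (d0 : dart L) (big : region L').
Hypothesis m_big : forall s, m s = None <-> s = big.

(** For an injective [m] no region is cut, and [m] is a bijection onto [option (region L)] that
    sends the unstarred region [big] to [None]. RII refutes this case by counting. *)
Lemma extends_card_live : injective m ->
  #|[pred r : region L' | ~~ star_region r]|
    = #|[pred r : region L | ~~ star_region r]|.+1.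
Proof.
move=> m_inj.
rewrite -(card_imset [pred r : region L' | ~~ star_region r] m_inj).
rewrite -(card_imset [pred r : region L | ~~ star_region r] (@Some_inj _)).
have starE s r : m s = Some r -> star_region s = star_region r.
  by move=> ms; case: (extends_fiber ext ms) => // s'; rewrite -ms => /m_inj.
rewrite -add1n -[1%N](cards1 (None : option (region L))) -cardsUI.
rewrite (_ : [set None] :&: _ = set0) ?cards0 ?addn0; last first.
  apply/setP => t; rewrite !inE; apply/negP => /andP[/eqP-> /imsetP[r _ ]] //.
congr #|pred_of_set _|; apply/setP => -[r|]; rewrite !inE /=.
  rewrite mem_imset; last exact: Some_inj.
  apply/imsetP/idP => [[s sl ms]|rl]; first by rewrite inE -(starE s).
  have [s ms] := extends_region_surj ext d0 r.
  by exists s; rewrite // inE (starE s r).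
apply/imsetP; exists big; last by apply/esym/m_big.
by rewrite inE; case: ext => _ _ _ _ [->] //; apply/m_big.
Qed.

Lemma extends_card_unstarred : uniq new -> (forall d', d' \in new -> unstarred d') ->
  #|@unstarred g L'| = (#|@unstarred g L| + size new)%N.
Proof.
move=> u_new new_u; rewrite -(cardID (mem new) (@unstarred g L')) addnC.
congr (_ + _)%N.
  rewrite -(card_imset _ (extends_inj ext)); apply: eq_card => d'.
  rewrite !inE -(extends_codom ext); apply/andP/imsetP => [[/codomP[d ->]]|[d ud ->]].
    by rewrite -topredE /= (extends_unstarred ext) => ud; exists d.
  by rewrite codom_f -topredE /= (extends_unstarred ext).
rewrite -(card_uniqP u_new); apply: eq_card => d'; rewrite !inE andbC.
by have [/new_u|] := boolP (d' \in new).
Qed.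

(** If [r] is unstarred, so are both parts; a set covering [r] once marks one of them, and [q] must
    be the other. If [r] is starred, exactly one part is; [q] cannot be that part, and when [q] is
    the other, [S] must avoid both, as in [L]. *)
Lemma extends_covers_split (r : region L) (r1 r2 : region L') S :
  r1 != r2 -> (forall s, m s = Some r <-> s = r1 \/ s = r2) ->
  (forall s s', m s = m s' -> s = s' \/ m s = Some r) ->
  let cov q := covers (fun d => region_of (i d)) (fun s => ~~ star_region s)
    S [:: q; big] in
  (cov r1 + cov r2)%N = covers (@region_of g L) (fun t => ~~ star_region t) S [::].
Proof.
move=> r12 mr m_inj cov.
have m1 : m r1 = Some r by apply/mr; left.
have m2 : m r2 = Some r by apply/mr; right.
pose cnt' s := (\sum_(d in S) (region_of (i d) == s))%N.
pose cnt t := (\sum_(d in S) (region_of d == t))%N.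
have cnt_other s t : m s = Some t -> t != r ->
    cnt' s = cnt t /\ star_region s = star_region t.
  move=> ms tr; have [|iE ->] := extends_fiber ext ms.
    move=> s' ms'; have [//|] := m_inj s' s (etrans ms' (esym ms)).
    by rewrite ms' => -[/eqP]; rewrite (negbTE tr).
  by split=> //; apply: eq_bigr => d _; rewrite iE.
have cnt_r : cnt r = (cnt' r1 + cnt' r2)%N.
  rewrite /cnt /cnt' -big_split; apply: eq_bigr => d _ /=.
  have [dr|dr] := eqVneq (region_of d) r.
    have := extends_region ext d; rewrite dr => /mr[->|->].
      by rewrite eqxx (negbTE r12).
    by rewrite eqxx eq_sym (negbTE r12).
  have ir s : m s = Some r -> (region_of (i d) == s) = false.
    move=> ms; apply: contraNF dr => /eqP ids.
    by move: ms; rewrite -ids (extends_region ext) => -[->].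
  by rewrite !ir.
have star_r : (star_region r1 + star_region r2)%N = star_region r.
  case: ext => _ _ _ _ [_ <-]; rewrite -sum1dep_card big_mkcondr /=.
  rewrite (bigD1 r1) ?m1 //= (bigD1 r2) /= ?m2 ?eqxx 1?eq_sym //.
  rewrite big1 ?addn0 => [|s /andP[/andP[/eqP/mr sr] s1 s2]].
    by do 2 case: star_region.
  by case: sr s1 s2 => ->; rewrite eqxx.
have big_r s : m s = Some r -> (big == s) = false.
  by move=> ms; apply/eqP => bs; have := (m_big s).2 (esym bs); rewrite ms.
have cnt_big : cnt' big = 0%N.
  apply: big1 => d _; apply/eqP; rewrite eqb0; apply/eqP/m_big.
  by rewrite (extends_region ext).
have star_big : ~~ star_region big.
  by case: ext => _ _ _ _ [-> //]; apply/m_big.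
(* The conditions away from [r] are common to the three coverings and are split off. *)
pose good := [forall t, (t != r) ==> (cnt t == ~~ star_region t)].
have covE : covers (@region_of g L) (fun t => ~~ star_region t) S [::]
    = good && (cnt r == ~~ star_region r).
  apply/forallP/andP => [cS|[/forallP gS cr] t].
    by split; [apply/forallP => t; apply/implyP => _; exact: cS t | exact: cS r].
  by have [->//|tr] := eqVneq t r; exact: implyP (gS t) tr.
have cov'E q : m q = Some r -> cov q = [&& good,
    ((q == r1) + cnt' r1)%N == ~~ star_region r1 &
    ((q == r2) + cnt' r2)%N == ~~ star_region r2].
  move=> mq; apply/forallP/and3P => [cS|[/forallP gS c1 c2] s]; last first.
    case ms: (m s) => [t|].
      have [tr|tr] := eqVneq t r.
        by rewrite tr in ms; rewrite /= big_r //= !addn0;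
          have /mr[->|->] := ms.
      rewrite /= (_ : (q == s) = false); last first.
        by apply/eqP => qs; move: tr; rewrite qs ms in mq; case: mq => ->; rewrite eqxx.
      rewrite (_ : (big == s) = false); last first.
        by apply/eqP/nesym => /m_big; rewrite ms.
      have [cst ->] := cnt_other s t ms tr.
      by rewrite -/(cnt' s) cst; exact: implyP (gS t) tr.
    have -> : s = big by apply/m_big.
    by rewrite /= -/(cnt' big) cnt_big star_big eqxx [q == _]eq_sym big_r.
  split.
  - apply/forallP => t; apply/implyP => tr.
    have [s ms] := extends_region_surj ext d0 t.
    have [<- <-] := cnt_other s t ms tr.
    have := cS s; rewrite /= (_ : (q == s) = false); last first.
      by apply/eqP => qs; move: tr; rewrite qs ms in mq; case: mq => ->; rewrite eqxx.
    by rewrite (_ : (big == s) = false) //; apply/eqP/nesym => /m_big; rewrite ms.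
  - by have := cS r1; rewrite /= big_r //= !addn0.
  - by have := cS r2; rewrite /= big_r //= !addn0.
rewrite covE !cov'E // cnt_r !eqxx [r2 == _]eq_sym (negbTE r12).
move: (cnt' r1) (cnt' r2) => x y; move: star_r.
case: (good) => //=.
(* It only matters whether each count is 0, 1 or larger. *)
by case: (star_region r1); case: (star_region r2); case: (star_region r) => //= _;
  case: x => [|[|x]]; case: y => [|[|y]].
Qed.

End ExtendsSplit.

Lemma potential_reidemeister2 (g : nat) (A : comNzRingType) (W B : A)
    (L L' : starred_diagram g) : W * B = 1 ->
  reidemeister2 L L' -> potential L W B = potential L' W B.
Proof.
move=> WB [a [b [x [y [i [m [[_ _ rab] ext [x4 y4 xy oxy] [[ox oxx oy] [oby oyx oxb]]
  [m_big m_a m_inj]]]]]]]]; apply/esym.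
set big := region_of (nxt x) in m_big.
have nI := @nxt_injective g L'; have nC := fconnect_sym nI.
have new_unstarred d : d \in orbit (@nxt g L') x ++ orbit (@nxt g L') y -> unstarred d.
  move=> d_new; rewrite /unstarred; case: ext => _ _ _ [_ ->] //; rewrite andbT.
  move: d_new; rewrite mem_cat -!fconnect_orbit.
  by case/orP => /at_crossing_same_vertex ->.
have ux : unstarred x by rewrite new_unstarred // mem_cat -fconnect_orbit connect0.
have uy : unstarred y.
  by rewrite new_unstarred // mem_cat orbC -fconnect_orbit connect0.
have new_uniq : uniq (orbit (@nxt g L') x ++ orbit (@nxt g L') y).
  rewrite cat_uniq !orbit_uniq andbT; apply/hasPn => d /=; rewrite -!fconnect_orbit.
  by move=> yd; apply: contra xy => xd; apply: connect_trans xd _; rewrite nC.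
have m_ra : m (region_of (i a)) = Some (region_of a) by apply: extends_region ext _.
have m_rb : m (region_of (i b)) = Some (region_of a).
  by rewrite rab; apply: extends_region ext _.
(* The two parts of the cut region are distinct: otherwise the move would create
   two crossings but only one region. *)
have ra_rb : region_of (i a) != region_of (i b).
  apply/eqP => ra_rb.
  have m_inj' : injective m.
    move=> r s rs; have [//|/[dup] mr] := m_inj r s rs.
    rewrite {1}rs => /m_a ms; move/m_a: mr; rewrite ra_rb in ms *.
    by case: ms => ->; case=> ->.
  have := balance L'; rewrite (extends_card_live ext a m_big m_inj').
  rewrite (extends_card_unstarred ext new_uniq new_unstarred) -balance size_cat.
  by rewrite !size_orbit (eqP x4) (eqP y4) mulnS addnC => /addnI.
(* Walking along the new edges identifies the corners: [x] and [nxt^3 y] lie across the lower arc,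
   [nxt^2 x] and [nxt y] across the upper one. *)
have prev e d : nxt e = opp d -> region_of d = region_of e := @region_of_opp _ _ e d.
have r_n3x : region_of (nxt (nxt (nxt x))) = region_of (i a).
  by apply/esym/prev; rewrite nxt4 // ox.
have r_n3y : region_of (nxt (nxt (nxt y))) = region_of x by apply/prev; rewrite oyx.
have r_ny : region_of (nxt y) = region_of (nxt (nxt x)).
  by apply/esym/prev; rewrite oxx.
have r_n2y : region_of (nxt (nxt y)) = big.
  by apply/prev; rewrite -oxx opp_involutive.
have r_y : region_of y = region_of (i b) by apply/esym/prev; rewrite oby.
have i_big d : region_of (i d) != big.
  by apply/eqP => /m_big; rewrite (extends_region ext).
have prev_big e : region_of (opp (i e)) != big.
  by rewrite -(f_finv (@nxt_injective g L) e) -(extends_nxt ext) region_of_walk.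
have out2 d : at_crossing d -> out (nxt (nxt d)) = ~~ out d.
  by move=> /eqP/out_crossing.
(* Each strand runs through both crossings, which ties the orientations at [y] to those at [x]. *)
have out_y : out y = ~~ out x.
  by apply: negb_inj; rewrite negbK -out2 // -oxx out_opp out2 // negbK.
have out_ny : out (nxt y) = out (nxt x).
  by rewrite -oyx out_opp out2 ?at_crossing_nxt // negbK.
rewrite !potentialE (state_sum_crossing _ _ _ _ _ (@unstarred_nxt g L') ux x4).
under eq_crossing_sum => q.
  rewrite (state_sum_crossing _ _ _ _ _ _ _ y4); first over.
    by move=> d; rewrite same_vertex_nxt unstarred_nxt.
  by rewrite uy.
rewrite r_n3x r_n3y r_ny r_n2y r_y out_y out_ny -oxy -/big.
set K' := fun d => _ && _ && _.
pose F q1 q2 := state_sum (@nxt g L') (@region_of g L')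
  (fun r => ~~ star_region r) (label W B) K' [:: q2; q1].
rewrite (@crossing_sum_bigon _ _ _ WB _ F); first last.
- move=> q1 q2 q1b q2b; apply: (@state_sum_uncovered _ _ _ _ _ _ _ _ big).
  + by case: ext => _ _ _ _ [->] //; apply/m_big.
  + by rewrite !inE ![big == _]eq_sym (negbTE q1b) (negbTE q2b).
  + move=> d /andP[/andP[_ xd] yd].
    have : d \in codom i.
      by rewrite (extends_codom ext) mem_cat -!fconnect_orbit negb_or; apply/andP.
    by case/codomP => e ->.
- by apply: (@state_sum_dup _ _ _ _ _ _ _ _ big); rewrite /= eqxx.
- by move=> q1 q2; apply/state_sum_perm/permP => r /=; rewrite addnCA.
- exact: i_big.
- exact: i_big.
- by rewrite -r_ny -oby.
- by rewrite -ox.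
have K'E d : K' d = unstarred d
    && (d \notin orbit (@nxt g L') x ++ orbit (@nxt g L') y).
  by rewrite mem_cat negb_or -!fconnect_orbit andbA.
(* For each set of old corners, the two coverings add up to the covering in [L]. *)
rewrite /F !(extends_state_sum ext) // -big_split; apply: eq_bigr => S _ /=.
by rewrite -mulrnDr (extends_covers_split ext a m_big S ra_rb m_a m_inj).
Qed.


Theorem theorem1 (g : nat) (L L' : starred_diagram g) :
  star_equivalent L L' ->
  forall (A : comNzRingType) (W B : A),
    W * B = 1 -> potential L W B = potential L' W B.
Proof.
move=> LL' A W B WB.
elim: LL' => {L L'} [L L' move | L | L L' _ -> | L1 L2 L3 _ -> _ ->] //.
case: move => [[]|||].
- exact: potential_isotopic.
- exact: potential_subdivision.
- exact: potential_reidemeister1.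
- exact: potential_reidemeister2.
- exact: potential_reidemeister3.
Qed.
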